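(* Let $P(G;X)=\sum_{i=0}^{s(G)}h_i(G)X^i$ be a univariate graph polynomial, where $s(G)$ and the $h_i(G)$ are graph parameters with values in $\mathbb{N}=\{0,1,2,\ldots\}$ and $h_i(G)=0$ for $i>s(G)$. Then there exist two univariate graph polynomials $P_1(G;X)$ and $P_2(G;X)$, both substitution equivalent to $P(G;X)$, such that for every graph $G$ for which $P(G;X)$ is not the zero polynomial: (1) $P_1(G;X)$ has no negative real roots, and (2) $P_2(G;X)$ has no real roots besides possibly $0$.
   Context: Graphs are finite, simple and undirected. A graph parameter is a function on graphs invariant under isomorphism. A univariate graph polynomial (with integer coefficients) is of the form $\sum_{i=0}^{s(G)}h_i(G)X^i$ with $s$ a graph parameter with values in $\mathbb{N}$ and the $h_i$ integer-valued graph parameters. Two graphs are similar if they have the same number of vertices, the same number of edges and the same number of connected components. A similarity function (in one indeterminate) assigns to each graph $G$ an analytic function $g(G;\cdot)$ on a nonempty open set $U_G\subseteq\mathbb{C}$, where both $U_G$ and $g(G;\cdot)$ depend only on the similarity class of $G$ (typical examples: polynomials, rational functions, branches of roots). $P$ is substitution reducible to $Q$ if there is a similarity function $g$ with $P(G;x)=Q(G;g(G;x))$ for all graphs $G$ and all $x\in U_G$. $P$ and $Q$ are substitution equivalent if each is substitution reducible to the other. *)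

(* Defs.v *)
From mathcomp Require Import all_boot all_order all_algebra.
From mathcomp Require Import complex.
From mathcomp Require Import all_classical all_reals all_analysis.

Set Implicit Arguments.
Unset Strict Implicit.
Unset Printing Implicit Defensive.

Import Order.TTheory GRing.Theory Num.Theory.
Import numFieldNormedType.Exports.

Local Open Scope ring_scope.

(* Finite simple undirected graphs; the graph without vertices is allowed. *)
Record graph : Type := Graph {
  vertex :> finType;
  edge : rel vertex;
  edge_sym : symmetric edge;
  edge_irr : irreflexive edge
}.

Definition isomorphic (G H : graph) : Prop :=
  exists2 f : G -> H, bijective f & forall x y : G, edge (f x) (f y) = edge x y.

Definition graph_parameter (T : Type) (f : graph -> T) : Prop :=
  forall G H : graph, isomorphic G H -> f G = f H.

Definition nb_vertices (G : graph) : nat := #|G|.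

Definition nb_edges (G : graph) : nat :=
  #|[set e : {set G} | [exists x, exists y, edge x y && (e == [set x; y])]]|.

Definition nb_components (G : graph) : nat := n_comp (@edge G) predT.

Definition similar (G H : graph) : Prop :=
  [/\ nb_vertices G = nb_vertices H,
      nb_edges G = nb_edges H &
      nb_components G = nb_components H].

Definition graph_polynomial (P : graph -> {poly int}) : Prop :=
  exists (s : graph -> nat) (h : nat -> graph -> int),
    [/\ graph_parameter s,
        forall i : nat, graph_parameter (h i) &
        forall G : graph, P G = \sum_(i < (s G).+1) h i G *: 'X^i].

Local Open Scope classical_set_scope.

(* R[i] itself carries no topology: the library puts the norm topology of a
   numFieldType T on the alias T^o. *)

(* f is the sum of a power series centred at z in a neighbourhood of every
   point z of U. *)
Definition analytic_on (R : realType) (U : set (R[i])^o)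
    (f : (R[i])^o -> (R[i])^o) : Prop :=
  forall z : (R[i])^o, U z ->
    exists a : nat -> (R[i])^o,
      \forall w \near z, series (fun n => a n * (w - z) ^+ n) @ \oo --> f w.

(* The function attached to G is total; only its restriction to U G matters. *)
Definition similarity_function (R : realType) (U : graph -> set (R[i])^o)
    (g : graph -> (R[i])^o -> (R[i])^o) : Prop :=
  (forall G : graph, [/\ open (U G), U G !=set0 & analytic_on (U G) (g G)]) /\
  (forall G H : graph, similar G H ->
     U G = U H /\ {in U G, g G =1 g H}).

Definition substitution_reducible (R : realType)
    (P Q : graph -> {poly int}) : Prop :=
  exists (U : graph -> set (R[i])^o) (g : graph -> (R[i])^o -> (R[i])^o),
    similarity_function U g /\
    forall (G : graph) (x : (R[i])^o), U G x ->
      (map_poly intr (P G)).[x] = (map_poly intr (Q G)).[g G x].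

Definition substitution_equivalent (R : realType)
    (P Q : graph -> {poly int}) : Prop :=
  substitution_reducible R P Q /\ substitution_reducible R Q P.

(* Main.v *)
(* Take P1 = P(-X) and P2 = P(X^2): a nonzero polynomial with nonnegative
   coefficients is positive on the positive reals.  Equivalence only needs
   analytic sections of -X and X^2, and for X^2 the principal square root on the
   upper half plane is one.  Its power series at z comes from the generating
   series y(t) of the Catalan numbers, the solution of y = 1 + t y^2 near 1,
   through sqrt (z (1 - 4t)) = sqrt z (1 - 2 t y(t)). *)

Require Import Defs.
From mathcomp Require Import all_boot all_order all_algebra.
From mathcomp Require Import complex.
From mathcomp Require Import all_classical all_reals all_analysis.
From mathcomp Require Import ring.

Import Order.TTheory GRing.Theory Num.Theory.
Import numFieldNormedType.Exports.
Local Open Scope ring_scope.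

(** * Error bounds for the Catalan series *)

(* The n-th Picard iterate of y = 1 + t y^2.  Its coefficients below degree n
   are those of the limit, so that catalan_coef n is the n-th Catalan number. *)
Definition catalan_poly (C : numFieldType) (n : nat) : {poly C} :=
  iter n (fun p => 1 + 'X * p ^+ 2) 0.

Definition catalan_coef (C : numFieldType) (n : nat) : C :=
  (catalan_poly C n.+1)`_n.

Lemma catalan_polyS (C : numFieldType) n :
  catalan_poly C n.+1 = 1 + 'X * catalan_poly C n ^+ 2.
Proof. by []. Qed.

Lemma catalan_poly_coef_ge0 (C : numFieldType) n i : 0 <= (catalan_poly C n)`_i.
Proof.
elim: n i => [|n IHn] i; first by rewrite coef0.
rewrite catalan_polyS coefD coef1 coefXM addr_ge0 ?ler0n //.
case: ifP => // _; rewrite expr2 coefM sumr_ge0 // => j _.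
by rewrite mulr_ge0.
Qed.

(** Consecutive iterates agree modulo ['X^k]: a difference of squares contains the previous
    difference, and the recursion multiplies it by one more ['X]. *)
Lemma catalan_poly_stab (C : numFieldType) n m i : (i < n)%N ->
  (catalan_poly C (n + m))`_i = (catalan_poly C n)`_i.
Proof.
have step k : exists r,
    catalan_poly C k.+1 - catalan_poly C k = 'X^k * r.
  elim: k => [|k [r Hr]].
    by exists (catalan_poly C 1 - catalan_poly C 0); rewrite mul1r.
  exists (r * (catalan_poly C k.+1 + catalan_poly C k)).
  rewrite mulrA exprS -[_ * r]mulrA -Hr [catalan_poly C k.+2]catalan_polyS.
  by rewrite [in X in _ - X]catalan_polyS; ring.
move=> i_n; elim: m => [|m IHm]; first by rewrite addn0.
have [r /(congr1 (fun p : {poly C} => p`_i))] := step (n + m)%N.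
rewrite coefB coefXnM ltn_addr // -addnS => /eqP.
by rewrite subr_eq0 => /eqP ->.
Qed.

Lemma horner_catalan_polyS (C : numFieldType) n (t : C) :
  (catalan_poly C n.+1).[t] = 1 + t * (catalan_poly C n).[t] ^+ 2.
Proof. by rewrite catalan_polyS !hornerE /= -mulrA. Qed.

(** At t = 1/4 the fixed point is 2, as 2 = 1 + 2^2 / 4, so y -> 1 + t y^2 preserves the disc of
    radius 2. *)
Lemma catalan_poly_bound (C : numFieldType) n (t : C) : `|t| <= 4^-1 ->
  `|(catalan_poly C n).[t]| <= 2.
Proof.
move=> tle; elim: n => [|n IHn]; first by rewrite horner0 normr0 ler0n.
rewrite horner_catalan_polyS.
rewrite -[leRHS](_ : 1 + 4^-1 * 2 ^+ 2 = 2 :> C); last by field.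
rewrite (le_trans (ler_normD _ _)) // normr1 lerD2l normrM normrX.
by rewrite ler_pM ?exprn_ge0 // ler_pXn2r ?nnegrE ?ler0n.
Qed.

(* The terms of degree at least n are at most (4 |t|)^n times their values at
   1/4, where the whole polynomial is at most 2. *)
Lemma catalan_poly_tail (C : numFieldType) n (t : C) : `|t| <= 16^-1 ->
  `|(catalan_poly C n).[t] - \sum_(i < n) catalan_coef C i * t ^+ i|
    <= 2 * 4^-1 ^+ n.
Proof.
move=> tle; set p := catalan_poly C n.
have -> : \sum_(i < n) catalan_coef C i * t ^+ i = \sum_(i < n) p`_i * t ^+ i.
  apply: eq_bigr => i _; congr (_ * _).
  rewrite /catalan_coef -(@catalan_poly_stab _ _ (n - i.+1)) //.
  by rewrite subnKC.
rewrite (@horner_coef_wide _ (n + size p)) ?leq_addl // big_split_ord /=.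
rewrite [X in X - _]addrC addrK.
have q_ge0 : (0 : C) <= 4^-1 by rewrite invr_ge0 ler0n.
apply: (@le_trans _ _ (4^-1 ^+ n * p.[4^-1])); last first.
  rewrite mulrC ler_wpM2r ?exprn_ge0 //.
  rewrite -[leLHS]ger0_norm ?catalan_poly_bound ?ger0_norm // horner_coef.
  by apply: sumr_ge0 => i _; rewrite mulr_ge0 ?catalan_poly_coef_ge0 ?exprn_ge0.
rewrite (@horner_coef_wide _ (n + size p)) ?leq_addl // big_split_ord /=.
rewrite mulrDr; apply: ler_wpDl.
  apply: mulr_ge0; first exact: exprn_ge0.
  by apply: sumr_ge0 => i _; rewrite mulr_ge0 ?catalan_poly_coef_ge0 ?exprn_ge0.
rewrite mulr_sumr; apply: le_trans (ler_norm_sum _ _ _) _.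
apply: ler_sum => i _.
rewrite normrM normrX (ger0_norm (catalan_poly_coef_ge0 _ _ _)) mulrCA.
rewrite ler_wpM2l ?catalan_poly_coef_ge0 //.
apply: (@le_trans _ _ (16^-1 ^+ (n + i))).
  by rewrite lerXn2r ?nnegrE ?invr_ge0 ?ler0n.
have -> : 16^-1 = 4^-1 * 4^-1 :> C by field.
rewrite exprMn ler_wpM2r ?exprn_ge0 // exprD ler_piMr ?exprn_ge0 //.
by rewrite exprn_ile1 // invf_le1 ?ltr0n // ler1n.
Qed.

(** On the disc of radius 2 the map y -> 1 + t y^2 contracts by |t| |y + y'| <= 4/16, and the
    starting error is |y| <= 2. *)
Lemma catalan_poly_fixpoint (C : numFieldType) n (t y : C) :
  `|t| <= 16^-1 -> `|y| <= 2 -> y = 1 + t * y ^+ 2 ->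
  `|(catalan_poly C n).[t] - y| <= 2 * 4^-1 ^+ n.
Proof.
move=> tle yle yE.
elim: n => [|n IHn]; first by rewrite horner0 sub0r normrN mulr1.
have qle : `|(catalan_poly C n).[t]| <= 2.
  apply: catalan_poly_bound; apply: le_trans tle _.
  by rewrite lef_pV2 ?posrE ?ltr0n // ler_nat.
rewrite horner_catalan_polyS [in X in _ - X]yE.
have -> : 1 + t * (catalan_poly C n).[t] ^+ 2 - (1 + t * y ^+ 2) =
  (t * ((catalan_poly C n).[t] + y)) * ((catalan_poly C n).[t] - y) by ring.
rewrite exprS mulrCA normrM ler_pM // normrM.
rewrite -[leRHS](_ : 16^-1 * 4 = 4^-1 :> C); last by field.
rewrite ler_pM // (le_trans (ler_normD _ _)) //.
by rewrite -[leRHS](_ : 2 + 2 = 4 :> C) ?lerD // -natrD.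
Qed.

Lemma catalan_series_near (C : numFieldType) n (t y : C) :
  `|t| <= 16^-1 -> `|y| <= 2 -> y = 1 + t * y ^+ 2 ->
  `|y - \sum_(i < n) catalan_coef C i * t ^+ i| <= 4 * 4^-1 ^+ n.
Proof.
move=> tle yle yE.
have -> : 4 * 4^-1 ^+ n = 2 * 4^-1 ^+ n + 2 * 4^-1 ^+ n :> C by ring.
apply: le_trans (ler_distD (catalan_poly C n).[t] _ _) (lerD _ _).
  by rewrite distrC; apply: catalan_poly_fixpoint.
exact: catalan_poly_tail.
Qed.

(** * Convergence and analyticity over [R[i]] *)

Lemma Im_le_normC (C : numClosedFieldType) (z : C) : 'Im z <= `|z|.
Proof.
have [] := leif_Re_Creal (- ('i * z)).
by rewrite raddfN /= ReMil opprK normrN normrM normCi mul1r.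
Qed.

(** Both [M] and the tolerance are real elements of [R[i]], so the convergence comes from a
    geometric sequence in [R]. *)
Lemma cvg_le_geometric (R : realType) (u : nat -> R[i]^o) (l : R[i]^o)
    (M : R[i]) :
  (forall n, `|l - u n| <= M * 4^-1 ^+ n) -> (u n @[n --> \oo] --> l)%classic.
Proof.
move=> ule; have M_ge0 : 0 <= M.
  by have := ule 0%N; rewrite mulr1; apply: le_trans.
apply/cvgrPdist_le => e e_gt0.
have /complex_realP [a aE]: M \is Num.real by exact: ger0_real.
have /complex_realP [b bE]: e \is Num.real by exact: gtr0_real.
have q_lt1 : `|4^-1 : R| < 1.
  by rewrite ger0_norm ?invr_ge0 // invf_lt1 // ltr1n.
have /cvgrPdist_le/(_ b) := cvg_geometric a q_lt1.
have b_gt0 : 0 < b by rewrite -ltcR -bE.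
move=> /(_ b_gt0); apply: filterS => n /=.
rewrite sub0r normrN => nle; apply: le_trans (ule n) _.
rewrite aE bE.
have -> : a%:C%C * 4^-1 ^+ n = (geometric a 4^-1 n)%:C%C.
  by rewrite /geometric /= rmorphM rmorphXn fmorphV rmorph_nat.
by rewrite lecR (le_trans (ler_norm _)).
Qed.

Lemma analytic_on_poly (R : realType) (U : set R[i]^o) (p : {poly R[i]}) :
  analytic_on U (horner p).
Proof.
(* The Taylor expansion at [z] is finite, so its partial sums are eventually constant. *)
move=> z _; exists (fun n => (p \Po ('X + z%:P))`_n).
apply: filterE => w; apply: cvg_near_cst.
exists (size (p \Po ('X + z%:P))) => // n /= le_n.
rewrite /series /= big_mkord -horner_coef_wide //.
by rewrite horner_comp !hornerE subrK.
Qed.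

Lemma half_plane_open (R : realType) :
  open [set z : R[i]^o | 0 < 'Im z]%classic.
Proof.
rewrite openE => z /= z_gt0; apply/nbhs_ballP; exists ('Im z) => //= w.
rewrite -ball_normE /= => zw.
have : 'Im z - 'Im w < 'Im z.
  by rewrite -raddfB; apply: (le_lt_trans _ zw); exact: Im_le_normC.
by rewrite ltrBlDr ltrDl.
Qed.

(** * The principal square root on the upper half plane *)

(** The principal root a has Im a >= 0, and Im (a^2) = 2 Re a Im a is positive. *)
Lemma sqrtC_quadrant (C : numClosedFieldType) (w : C) : 0 < 'Im w ->
  0 < 'Re (sqrtC w) /\ 0 < 'Im (sqrtC w).
Proof.
set a := sqrtC w; move=> w_gt0.
have Im_ge0 : 0 <= 'Im a by exact: Im_rootC_ge0.
have wE : 'Im w = 'Re a * 'Im a *+ 2.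
  by rewrite -[w]sqrtCK -/a expr2 ImM -mulr2n.
have : 0 < 'Re a * 'Im a by rewrite -(@pmulrn_lgt0 _ _ 2) // -wE.
have Im_neq0 : 'Im a != 0.
  by apply: contraTneq w_gt0; rewrite wE => ->; rewrite mulr0 mul0rn ltxx.
have Im_gt0 : 0 < 'Im a by rewrite lt_def Im_neq0.
by rewrite pmulr_lgt0.
Qed.

(* On the upper half plane sqrtC takes its values in the open first quadrant, so
   a quotient of two values has nonnegative real part. *)
Lemma sqrtC_ratio (C : numClosedFieldType) (w z : C) : 0 < 'Im w -> 0 < 'Im z ->
  1 <= `|1 + sqrtC w / sqrtC z|.
Proof.
move=> /sqrtC_quadrant [Rw Iw] /sqrtC_quadrant [Rz Iz].
have Re_le (x : C) : 'Re x <= `|x| by rewrite leif_Re_Creal.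
apply: le_trans (Re_le _).
rewrite raddfD /= (Creal_ReP _ _) ?real1 // lerDl Re_div.
by rewrite divr_ge0 ?exprn_ge0 // addr_ge0 // mulr_ge0 // ltW.
Qed.

(** Taylor coefficients of the square root at [z]: put t = - (w - z) / (4z) in sqrt z (1 - 2 t
    y(t)). The factor t shifts the Catalan index by one. *)
Definition sqrtC_coef {C : numClosedFieldType} (z : C) (n : nat) : C :=
  if n is k.+1
  then - (2 * sqrtC z) * catalan_coef C k * (- (4 * z)^-1) ^+ k.+1
  else sqrtC z.

(* With w = z (1 - 4 t) and q = sqrtC w / sqrtC z, the number y = 2 / (1 + q) is
   the root of y = 1 + t y^2 that satisfies |y| <= 2. *)
Lemma sqrtC_series_near (C : numClosedFieldType) (w z : C) n :
  0 < 'Im w -> 0 < 'Im z -> `|z - w| <= `|z| / 4 ->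
  `|sqrtC w - \sum_(i < n) sqrtC_coef z i * (w - z) ^+ i|
    <= `|sqrtC z| * 2 * 4^-1 ^+ n.
Proof.
move=> w_gt0 z_gt0 zw.
have z_neq0 : z != 0 by apply: contraTneq z_gt0 => ->; rewrite raddf0 ltxx.
have r_neq0 : sqrtC z != 0 by rewrite sqrtC_eq0.
set t := (z - w) / (4 * z).
have tle : `|t| <= 16^-1.
  rewrite normrM normfV normrM (ger0_norm (ler0n _ 4)) ler_pdivrMr; last first.
    by rewrite mulr_gt0 ?normr_gt0.
  by apply: le_trans zw _; rewrite le_eqVlt; apply/orP; left; apply/eqP; field.
set q := sqrtC w / sqrtC z.
have q_ge1 : 1 <= `|1 + q| by exact: sqrtC_ratio.
have q1_neq0 : 1 + q != 0 by rewrite -normr_gt0 (lt_le_trans ltr01).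
have q2 : q ^+ 2 = 1 - 4 * t.
  by rewrite /q expr_div_n !sqrtCK /t; field.
have tE : t = (1 - q ^+ 2) / 4 by rewrite q2; field.
set y := 2 / (1 + q).
have yle : `|y| <= 2.
  rewrite normrM normfV (ger0_norm (ler0n _ 2)) ler_piMr // invf_le1 //.
  exact: lt_le_trans q_ge1.
have yE : y = 1 + t * y ^+ 2 by rewrite tE /y; field.
have qE : q = 1 - 2 * t * y by rewrite tE /y; field.
have -> : sqrtC w = sqrtC z * q by rewrite /q mulrC divfK.
(* The empty sum lacks even the constant term; there |q| <= 1 + 2 |t| |y| <= 5/4. *)
case: n => [|n].
  clearbody t y; rewrite big_ord0 subr0 mulr1 normrM ler_wpM2l // qE.
  rewrite (le_trans (ler_normB _ _)) // normr1 !normrM (ger0_norm (ler0n _ 2)).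
  apply: (@le_trans _ _ (1 + 2 * 16^-1 * 2)).
    by rewrite lerD2l ler_pM ?mulr_ge0 // ler_pM.
  rewrite -subr_ge0 (_ : _ - _ = 3 / 4); last by field.
  by rewrite divr_ge0.
rewrite big_ord_recl /= mulr1.
have -> : \sum_(i < n) sqrtC_coef z (lift ord0 i) * (w - z) ^+ lift ord0 i =
    - (2 * sqrtC z * t) * \sum_(i < n) catalan_coef C i * t ^+ i.
  rewrite mulr_sumr; apply: eq_bigr => i _.
  rewrite lift0 /= -!mulrA -exprMn.
  have -> : - (4 * z)^-1 * (w - z) = t by rewrite /t; field.
  by rewrite exprS; ring.
(* The constant terms cancel, leaving the Catalan error at [n] times - 2 t sqrt z; |t| <= 1/16 turns
   4 * 4^-n into 4^-(n+1). *)
have -> : sqrtC z * q - (sqrtC z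
      + - (2 * sqrtC z * t) * \sum_(i < n) catalan_coef C i * t ^+ i) =
    sqrtC z * (- 2 * t) * (y - \sum_(i < n) catalan_coef C i * t ^+ i).
  by rewrite qE; ring.
clearbody t y; rewrite !normrM normrN (ger0_norm (ler0n _ 2)) -!mulrA.
rewrite ler_wpM2l // ler_wpM2l //.
have -> : 4^-1 ^+ n.+1 = 16^-1 * (4 * 4^-1 ^+ n) :> C by rewrite exprS; field.
by rewrite ler_pM // catalan_series_near.
Qed.

Lemma analytic_on_sqrtC (R : realType) :
  analytic_on [set z : R[i]^o | 0 < 'Im z]%classic (sqrtC : R[i]^o -> R[i]^o).
Proof.
move=> z /= z_gt0; exists (sqrtC_coef z).
have z_neq0 : z != 0 by apply: contraTneq z_gt0 => ->; rewrite raddf0 ltxx.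
near=> w.
have w_gt0 : 0 < 'Im w.
  by near: w; apply: open_nbhs_nbhs; split => //; exact: half_plane_open.
apply: (@cvg_le_geometric _ _ _ (`|sqrtC z| * 2)) => n.
rewrite /series /= big_mkord; apply: sqrtC_series_near => //.
apply: ltW; near: w; apply/nbhs_ballP; exists (`|z| / 4) => //=.
by rewrite divr_gt0 ?normr_gt0.
Unshelve. all: by end_near.
Qed.

(** * Reductions by a substitution common to all graphs *)

Lemma similarity_function_cst (R : realType) (U : set R[i]^o)
    (g : R[i]^o -> R[i]^o) :
  open U -> (U !=set0)%classic -> analytic_on U g ->
  similarity_function (fun=> U) (fun=> g).
Proof. by []. Qed.

Lemma graph_polynomial_parameter (P : graph -> {poly int}) :
  graph_parameter P -> graph_polynomial P.
Proof.
(* The sum runs up to index [size (P G)], one past the degree, which also covers the zero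
   polynomial; the top term vanishes. *)
move=> P_param; exists (fun G => size (P G)), (fun i G => (P G)`_i).
split=> [G H /P_param -> // | i G H /P_param -> // | G].
by rewrite big_ord_recr /= nth_default // scale0r addr0 -poly_def coefK.
Qed.

Lemma map_intr_comp_horner (C : comNzRingType) (p q : {poly int}) (x : C) :
  (map_poly intr (p \Po q)).[x] = (map_poly intr p).[(map_poly intr q).[x]].
Proof. by rewrite map_comp_poly horner_comp. Qed.

Lemma comp_substitution_reducible (R : realType) (P : graph -> {poly int})
    (q : {poly int}) :
  substitution_reducible R (fun G => P G \Po q) P.
Proof.
exists (fun=> setT), (fun=> horner (map_poly intr q)); split.
  apply: similarity_function_cst; first exact: openT.
    by exists 0.
  exact: analytic_on_poly.
by move=> G x _; rewrite map_intr_comp_horner.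
Qed.

(** P(x) = P(q(g(x))) on [U]: a local branch suffices to undo a noninjective [q]. *)
Lemma section_substitution_reducible (R : realType) (P : graph -> {poly int})
    (q : {poly int}) (U : set R[i]^o) (g : R[i]^o -> R[i]^o) :
  open U -> (U !=set0)%classic -> analytic_on U g ->
  (forall x, U x -> (map_poly intr q).[g x] = x) ->
  substitution_reducible R P (fun G => P G \Po q).
Proof.
move=> Uo U0 g_an gK; exists (fun=> U), (fun=> g).
split=> [|G x Ux]; first exact: similarity_function_cst.
by rewrite map_intr_comp_horner gK.
Qed.

Lemma horner_coef_ge0_gt0 (R : numDomainType) (p : {poly R}) (x : R) :
  p != 0 -> (forall i, 0 <= p`_i) -> 0 < x -> 0 < p.[x].
Proof.
move=> p_neq0 p_ge0 x_gt0.
have x_ge0 i : 0 <= x ^+ i by rewrite exprn_ge0 // ltW.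
rewrite -size_poly_gt0 in p_neq0.
(* The leading term is split off: it is positive, the others are nonnegative. *)
rewrite horner_coef -(prednK p_neq0) big_ord_recr /= ltr_wpDl //.
  by apply: sumr_ge0 => i _; rewrite mulr_ge0.
rewrite mulr_gt0 ?exprn_gt0 // lt_def p_ge0 andbT.
by rewrite lead_coef_eq0 -size_poly_gt0.
Qed.

Theorem theorem4p10 (R : realType)
    (s : graph -> nat) (h : nat -> graph -> nat) (P : graph -> {poly int})
    (s_param : graph_parameter s)
    (h_param : forall i : nat, graph_parameter (h i))
    (h_gt : forall (G : graph) (i : nat), (s G < i)%N -> h i G = 0%N)
    (PE : forall G : graph, P G = \sum_(i < (s G).+1) (h i G)%:Z *: 'X^i) :
  exists P1 P2 : graph -> {poly int},
    [/\ graph_polynomial P1 /\ graph_polynomial P2,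
        substitution_equivalent R P1 P,
        substitution_equivalent R P2 P &
        forall G : graph, P G != 0 ->
          (forall x : R, root (map_poly intr (P1 G)) x -> ~ (x < 0)) /\
          (forall x : R, root (map_poly intr (P2 G)) x -> x = 0)].
Proof.
have P_param : graph_parameter P.
  move=> G H GH; rewrite !PE (s_param _ _ GH).
  by apply: eq_bigr => i _; rewrite (h_param _ _ _ GH).
have P_gt0 (G : graph) (x : R) : P G != 0 -> 0 < x ->
    0 < (map_poly intr (P G)).[x].
  move=> P_neq0; apply: horner_coef_ge0_gt0 => [|i].
    rewrite -(rmorph0 (map_poly intr)) inj_eq //.
    exact: map_inj_poly intr_inj _.
  rewrite coef_map /= ler0z PE coef_sum sumr_ge0 // => j _.
  by rewrite coefZ coefXn mulr_ge0 // ler0n.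
exists (fun G => P G \Po (- 'X)), (fun G => P G \Po 'X^2); split.
- by split; apply: graph_polynomial_parameter => G H /P_param ->.
- split; first exact: comp_substitution_reducible.
  (* The substitution - X is its own inverse on the whole plane. *)
  apply: (@section_substitution_reducible _ _ _ setT (horner (- 'X))).
  + exact: openT.
  + by exists 0.
  + exact: analytic_on_poly.
  + by move=> x _; rewrite rmorphN /= map_polyX !hornerE opprK.
- split; first exact: comp_substitution_reducible.
  apply: (section_substitution_reducible _ _ _ _ _ (half_plane_open R) _
    (analytic_on_sqrtC R)).
    by exists 'i; rewrite /= Im_i.
  by move=> x _; rewrite map_polyXn hornerXn sqrtCK.
(* A negative root of [P1] or a nonzero real root of [P2] would give [P G] the positive root - x or
   x^2. *)
move=> G P_neq0; split=> x; rewrite /root map_intr_comp_horner => Px0.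
  move=> x_lt0; move: Px0.
  by rewrite rmorphN /= map_polyX !hornerE gt_eqF // P_gt0 // oppr_gt0.
apply/eqP; apply: contraTT Px0 => x_neq0.
by rewrite map_polyXn hornerXn gt_eqF // P_gt0 // exprn_even_gt0.
Qed.
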